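(* Let $x,y$ be real numbers with $x+y\neq 0$ and $\frac{x}{x+y}\geq 0$, and let $n\in\mathbb{N}=\{1,2,3,\ldots\}$. Then $$\sum_{k=0}^n x^k y^{n-k}\binom{n}{k}\,\bar H_k=\sum_{j=1}^n \frac{y^j-(y-x)^j}{j}\,(x+y)^{n-j},$$ where $\bar H_k$ is the alternating $k$-th harmonic number.
   Context: The alternating harmonic numbers are $\bar H_k:=\sum_{j=1}^k \frac{(-1)^{j-1}}{j}$ for $k\geq 1$, and $\bar H_0:=0$. Convention: $0^0=1$ in the powers $x^k y^{n-k}$. *)

(* Defs.v *)
From mathcomp Require Import all_boot all_order all_algebra.
From mathcomp Require Import reals.

Set Implicit Arguments.
Unset Strict Implicit.
Unset Printing Implicit Defensive.

Import Order.TTheory GRing.Theory Num.Theory.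

Local Open Scope ring_scope.

(* The range is empty for [k = 0], so [alt_harmonic R 0 = 0]. *)
Definition alt_harmonic (R : realType) (k : nat) : R :=
  \sum_(1 <= j < k.+1) (-1) ^+ j.-1 / j%:R.

(* Main.v *)
Require Import Defs.
From mathcomp Require Import all_boot all_order all_algebra.
From mathcomp Require Import reals.
From mathcomp Require Import ring.

Import Order.TTheory GRing.Theory Num.Theory.

Local Open Scope ring_scope.

(** Write [S n] for the left-hand side. Pascal's rule turns [S n.+1] into
    [(x + y) * S n] plus [x] times the same kind of binomial sum taken on the
    increments [(-1) ^+ k / k.+1] of the alternating harmonic numbers
    ([binomial_sum_recr]). Absorption, ['C(n, k) / k.+1 = 'C(n.+1, k.+1) / n.+1],
    makes that second contribution, up to the factor [- 1 / n.+1], the binomial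
    expansion of [(y - x) ^+ n.+1] without its first term [y ^+ n.+1]
    ([binomial_sum_alt_inv]), so
    [S n.+1 = (x + y) * S n + (y ^+ n.+1 - (y - x) ^+ n.+1) / n.+1].
    The right-hand side visibly obeys the same recurrence, and both sides vanish
    at [n = 0]. *)

Definition binomial_sum (R : comNzRingType) (x y : R) (a : nat -> R) n : R :=
  \sum_(0 <= k < n.+1) x ^+ k * y ^+ (n - k) * 'C(n, k)%:R * a k.

(** Pascal's rule: the last letter of a word of length [n.+1] is either [y], leaving
    the index alone, or [x], shifting it by one. *)
Lemma binomial_sumS (R : comNzRingType) (x y : R) (a : nat -> R) n :
  binomial_sum R x y a n.+1 =
    y * binomial_sum R x y a n + x * binomial_sum R x y (fun k => a k.+1) n.
Proof.
rewrite /binomial_sum big_nat_recl //.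
under eq_bigr => k _ do rewrite binS natrD mulrDr mulrDl subSS.
rewrite big_split /= addrA; congr (_ + _); last first.
  by rewrite mulr_sumr; apply: eq_bigr => k _; rewrite exprS; ring.
(* The top term carries 'C(n, n.+1) = 0, which aligns the two ranges. *)
rewrite big_nat_recr //= (@bin_small n n.+1) // mulr0 mul0r addr0.
rewrite [X in _ = y * X]big_nat_recl // mulrDr mulr_sumr.
congr (_ + _); first by rewrite !bin0 !subn0 !expr0 exprS; ring.
rewrite big_nat [RHS]big_nat; apply: eq_bigr => k /andP[_ lt_kn].
by rewrite -(subnSK lt_kn) [y ^+ (_.+1)]exprS; ring.
Qed.

Lemma binomial_sum_recr (R : comNzRingType) (x y : R) (a : nat -> R) n :
  binomial_sum R x y a n.+1 =
    (x + y) * binomial_sum R x y a n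
    + x * binomial_sum R x y (fun k => a k.+1 - a k) n.
Proof.
rewrite binomial_sumS.
have -> : binomial_sum R x y (fun k => a k.+1 - a k) n =
    binomial_sum R x y (fun k => a k.+1) n - binomial_sum R x y a n.
  by rewrite /binomial_sum -sumrB; apply: eq_bigr => k _; rewrite mulrBr.
by ring.
Qed.

(** The discrete form of integrating [(y - t) ^+ n] for [t] from 0 to [x]. *)
Lemma binomial_sum_alt_inv (R : numFieldType) (x y : R) n :
  x * binomial_sum R x y (fun k => (-1) ^+ k / k.+1%:R) n =
    (y ^+ n.+1 - (y - x) ^+ n.+1) / n.+1%:R.
Proof.
have n1_neq0 : n.+1%:R != 0 :> R by rewrite pnatr_eq0.
apply: (mulIf n1_neq0); rewrite divfK //.
rewrite exprDn -(big_mkord xpredT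
  (fun k => y ^+ (n.+1 - k) * (- x) ^+ k *+ 'C(n.+1, k))).
rewrite big_nat_recl // subn0 expr0 mulr1 bin0 mulr1n opprD addNKr -sumrN.
rewrite /binomial_sum mulr_sumr mulr_suml; apply: eq_bigr => k _.
have k1_neq0 : k.+1%:R != 0 :> R by rewrite pnatr_eq0.
have absorb : n.+1%:R * 'C(n, k)%:R = k.+1%:R * 'C(n.+1, k.+1)%:R :> R.
  by rewrite -!natrM mul_bin_diag.
rewrite subSS -mulr_natr [(- x) ^+ _]exprNn !exprS; apply: (mulfI k1_neq0).
transitivity (x * x ^+ k * y ^+ (n - k) * (-1) ^+ k * (n.+1%:R * 'C(n, k)%:R)).
  by move: k.+1%:R n.+1%:R k1_neq0 {n1_neq0 absorb} => c d c_neq0; field.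
by rewrite absorb; ring.
Qed.

Lemma alt_harmonicS (R : realType) k :
  alt_harmonic R k.+1 - alt_harmonic R k = (-1) ^+ k / k.+1%:R.
Proof. by rewrite /alt_harmonic big_nat_recr //= addrAC subrr add0r. Qed.

Theorem corollary1p4 (R : realType) (x y : R) (n : nat)
    (hxy : x + y != 0) (hx : 0 <= x / (x + y)) (hn : (1 <= n)%N) :
  \sum_(0 <= k < n.+1) x ^+ k * y ^+ (n - k) * 'C(n, k)%:R * alt_harmonic R k
  = \sum_(1 <= j < n.+1) (y ^+ j - (y - x) ^+ j) / j%:R * (x + y) ^+ (n - j).
Proof.
rewrite -[LHS]/(binomial_sum R x y (alt_harmonic R) n).
elim: n {hn} => [|n IHn].
  by rewrite /binomial_sum big_nat1 /alt_harmonic !big_geq // mulr0.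
rewrite binomial_sum_recr [in RHS]big_nat_recr //= subnn expr0 mulr1.
rewrite IHn mulr_sumr; congr (_ + _).
  rewrite [LHS]big_nat [RHS]big_nat; apply: eq_bigr => j /andP[_ le_jn].
  by rewrite subSn // exprS mulrCA.
rewrite -binomial_sum_alt_inv; congr (_ * _).
by apply: eq_bigr => k _; rewrite alt_harmonicS.
Qed.
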